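(* Let $P$ be a finite set of prime numbers. Then there exists a positive integer $x$ such that both of the following hold: (i) for every $p \in P$ there exist positive integers $a, b$ (which may depend on $p$) with $x = a^{p} + b^{p}$; (ii) for every prime number $p \notin P$ there do not exist positive integers $a, b$ with $x = a^{p} + b^{p}$. *)

(* Defs.v *)
From mathcomp Require Export all_boot.
From mathcomp Require Export finmap.

(* Main.v *)
(* Let N be the product of P and take x = 2^(N+1) = 2^N + 2^N. If p divides N,
   then 2^N is a p-th power. Conversely, if a^p + b^p = 2^m, remove common
   factors 2 until a and b are odd. For p = 2 the sum is then 2 mod 4; for p odd,
   (a^p + b^p)/(a + b) is odd, hence equal to 1. In both cases a = b = 1, so
   m = 1 mod p, that is, p divides N when m = N + 1. *)
Require Import Defs.
From mathcomp Require Import all_boot.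
From mathcomp Require Import finmap.
From mathcomp Require Import zify ring.

(** The cofactor is built by induction using [b - a]; the ordering [a <= b] keeps this subtraction
    from truncating. *)
Lemma odd_exponent_sum_factor (a b n : nat) : odd a -> odd b -> a <= b ->
  exists2 s, odd s & a ^ n.*2.+1 + b ^ n.*2.+1 = (a + b) * s.
Proof.
move=> oa ob le_ab; have [c eb] : exists c, b = a + c by exists (b - a); lia.
have oc : ~~ odd c by move: ob; rewrite eb oddD oa; case: (odd c).
elim: n => [|n [s os IHs]]; first by exists 1; rewrite ?expn1 ?muln1.
(* With [k = n.*2.+1], the next sum is a^2 (a^k + b^k) + b^k (b^2 - a^2), and b^2 - a^2 = (a + b) c.
   Since [c] is even, the new cofactor stays odd. *)
exists (a ^ 2 * s + b ^ n.*2.+1 * c).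
  by rewrite oddD !oddM oddX oa os (negbTE oc) andbF.
have expS2 d : d ^ n.+1.*2.+1 = d ^ 2 * d ^ n.*2.+1.
  by rewrite -expnD doubleS !addSn.
rewrite !expS2 mulnDr [(a + b) * (a ^ 2 * s)]mulnCA -IHs.
by move: (a ^ n.*2.+1) (b ^ n.*2.+1) => u v; rewrite eb; ring.
Qed.

Lemma odd_dvdn_pow2 (s m : nat) : odd s -> s %| 2 ^ m -> s = 1.
Proof.
move=> os /gcdn_idPl <-; apply/eqP.
by rewrite -/(coprime _ _) coprimeXr // coprimen2.
Qed.

Lemma odd_powers_sum_pow2 (p a b m : nat) : prime p -> odd a -> odd b ->
  a ^ p + b ^ p = 2 ^ m -> m = 1.
Proof.
move=> pr_p; wlog le_ab : a b / a <= b => [IH oa ob eq_ab|].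
  by case: (leqP a b) => [/IH|/ltnW/IH]; apply; rewrite // addnC.
move=> oa ob eq_ab.
have m_gt0 : 0 < m.
  case: m eq_ab => // /(congr1 odd); by rewrite oddD !oddX oa ob !orbT.
have [p2|op] := even_prime pr_p.
  case: m m_gt0 eq_ab => [|[|m]] // _ /(congr1 (modn^~ 4)).
  rewrite p2 !expnS expn0 !muln1; move: (2 ^ m) => t; nia.
have [s os es] := odd_exponent_sum_factor a b p./2 oa ob le_ab.
move: es; have -> : p./2.*2.+1 = p by rewrite -[RHS]odd_double_half op.
rewrite eq_ab => es.
have s1 : s = 1 by apply: (odd_dvdn_pow2 s m os); rewrite es dvdn_mull.
rewrite s1 muln1 -eq_ab in es.
(* Now [a ^ p + b ^ p = a + b]. Each power is at least its base, so neither can exceed it, which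
   forces both bases to be 1. *)
have a_gt0 := odd_gt0 oa; have b_gt0 := odd_gt0 ob; have p_gt1 := prime_gt1 pr_p.
have eq1 d : 0 < d -> d ^ p <= d -> d = 1.
  case: d => [|[|d]] // _; by rewrite leqNgt -{1}[d.+2]expn1 ltn_exp2l // p_gt1.
have leX d : 0 < d -> d <= d ^ p.
  by move=> d_gt0; rewrite -{1}[d]expn1 leq_pexp2l // ltnW.
have a1 : a = 1 by apply: eq1 => //; have := leX b b_gt0; lia.
have b1 : b = 1 by apply: eq1 => //; have := leX a a_gt0; lia.
move: eq_ab; rewrite a1 b1 exp1n => /esym/eqP.
by rewrite (eqn_exp2l _ 1) // => /eqP.
Qed.

Lemma powers_sum_pow2 (p a b m : nat) : prime p -> 0 < a -> 0 < b ->
  a ^ p + b ^ p = 2 ^ m.+1 -> p %| m.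
Proof.
move=> pr_p; have p_gt0 := prime_gt0 pr_p.
elim/ltn_ind: m a b => m IHm a b a_gt0 b_gt0 eq_ab.
have par : odd a = odd b.
  move/(congr1 odd): (eq_ab); rewrite oddD !oddX /= !(gtn_eqF p_gt0) /=.
  by case: (odd a) (odd b) => [] [].
case oa : (odd a).
  have [->] := odd_powers_sum_pow2 p a b m.+1 pr_p oa (etrans (esym par) oa) eq_ab.
  exact: dvdn0.
have half_even d : odd d = false -> d = 2 * d./2.
  by move=> od; rewrite mul2n -[LHS]odd_double_half od.
have ea := half_even a oa; have eb := half_even b (etrans (esym par) oa).
have a2_gt0 : 0 < a./2 by lia.
have b2_gt0 : 0 < b./2 by lia.
rewrite ea eb !expnMn -mulnDr in eq_ab.
(* The halved sum is at least 2, so 2^p is a proper divisor of 2^(m+1). Hence [p <= m], [m - p] does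
   not truncate, and the halved sum is again 2 to a successor exponent, as the induction
   requires. *)
have lt2 : 1 < a./2 ^ p + b./2 ^ p.
  by rewrite -[2]/(1 + 1) leq_add // expn_gt0 ?a2_gt0 ?b2_gt0.
have le_pm : p <= m.
  by rewrite -ltnS -(ltn_exp2l (m := 2)) // -eq_ab ltn_Pmulr // expn_gt0.
have e2 : a./2 ^ p + b./2 ^ p = 2 ^ (m - p).+1.
  apply/eqP; rewrite -(eqn_pmul2l (m := 2 ^ p)) ?expn_gt0 // eq_ab -expnD.
  by rewrite addnS subnKC.
rewrite -(subnK le_pm) dvdn_addl ?dvdnn //.
by apply: (IHm _ _ _ _ a2_gt0 b2_gt0 e2); lia.
Qed.

Theorem theorem2p1 (P : {fset nat}) (hP : forall p : nat, p \in P -> prime p) :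
  exists x : nat,
    [/\ 0 < x,
        forall p : nat, p \in P ->
          exists a b : nat, [/\ 0 < a, 0 < b & x = a ^ p + b ^ p]
      & forall p : nat, prime p -> p \notin P ->
          ~ exists a b : nat, [/\ 0 < a, 0 < b & x = a ^ p + b ^ p]].
Proof.
pose N := \prod_(p <- P) p.
exists (2 ^ N.+1); split => [|p pP|p pr_p pNP [a [b [a_gt0 b_gt0 eq_ab]]]].
- by rewrite expn_gt0.
- have dvd_pN : p %| N by rewrite /N (big_rem p) //= dvdn_mulr.
  (* The [p]-th power of either witness is [2 ^ N]. *)
  exists (2 ^ (N %/ p)), (2 ^ (N %/ p)).
  by rewrite !expn_gt0 -expnM divnK // expnS mul2n addnn.
- have := powers_sum_pow2 p a b N pr_p a_gt0 b_gt0 (esym eq_ab).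
  (* [big_seq] records that each factor [q] lies in [P], hence is prime; so if [p] divides the
     product, it equals some [q]. *)
  rewrite /N big_seq => dvd_pN; case/negP: pNP; move: dvd_pN.
  elim/big_ind: _ => [|u v IHu IHv|q qP].
  + by rewrite Euclid_dvd1.
  + by rewrite Euclid_dvdM // => /orP[].
  + by rewrite (dvdn_prime2 pr_p (hP q qP)) => /eqP ->.
Qed.
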